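(* Let $X$ be an infinite zero-dimensional Tychonoff space. Then $C_p(X)$ has a point-separating discrete subspace if and only if $C_p^2(X)$ has a point-separating discrete subspace.
   Context: $C_p(X)$ is the space of all continuous functions $X\to\mathbb{R}$ with the topology of pointwise convergence, and $C_p^n(X)$ is its $n$-th power $C_p(X)^n$. A set $F\subset C_p^n(X)$ is point-separating if for any distinct $x,y\in X$ there is $\langle f_1,\dots,f_n\rangle\in F$ with $f_i(x)\neq f_i(y)$ for some $i\le n$. A discrete subspace is a subset that is discrete in its subspace topology; it need not be closed. Zero-dimensional means $\dim X=0$ (covering dimension for Tychonoff spaces: every finite cover by functionally open sets has a finite refinement that is a cover by pairwise disjoint clopen sets). *)

(* Defs.v *)
From HB Require Import structures.
From mathcomp Require Import all_boot all_order all_algebra.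
From mathcomp Require Import all_classical all_reals all_analysis.

Set Implicit Arguments.
Unset Strict Implicit.
Unset Printing Implicit Defensive.

Import Order.TTheory GRing.Theory Num.Theory.
Import numFieldNormedType.Exports.

Local Open Scope classical_set_scope.
Local Open Scope ring_scope.

(* The topology is that of a subspace of the product R^X. *)
Definition Cp (R : realType) (X : topologicalType) : Type := continuousType X R.

HB.instance Definition _ (R : realType) (X : topologicalType) :=
  Topological.copy (Cp R X)
    (initial_topology (fun f : continuousType X R => (f : {ptws X -> R}))).

Definition Cpn (R : realType) (n : nat) (X : topologicalType) : Type :=
  {ptws 'I_n -> Cp R X}.

HB.instance Definition _ (R : realType) (n : nat) (X : topologicalType) :=
  Topological.copy (Cpn R n X) {ptws 'I_n -> Cp R X}.

Definition point_separating (R : realType) (X : topologicalType)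
    (F : set (Cp R X)) : Prop :=
  forall x y : X, x <> y -> exists2 f, F f & f x <> f y.

Definition point_separating_n (R : realType) (n : nat) (X : topologicalType)
    (F : set (Cpn R n X)) : Prop :=
  forall x y : X, x <> y -> exists2 f, F f & exists i : 'I_n, f i x <> f i y.

(* [set_type A] carries the subspace topology; the equation is the axiom of
   [discreteTopologicalType]. *)
Definition discrete_subspace (T : topologicalType) (A : set T) : Prop :=
  @nbhs (set_type A) (set_type A) = principal_filter.

(* By [uniform_separatorP], [completely_regular_space] is the separation of
   points from closed sets by continuous functions into [0, 1]. *)
Definition tychonoff_space (X : topologicalType) : Prop :=
  accessible_space X /\ completely_regular_space X.

Definition functionally_open (R : realType) (X : topologicalType)
    (U : set X) : Prop :=
  exists2 f : X -> R, continuous f & U = [set x | f x <> 0].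

(* This is dim X = 0 for the covering dimension; the library's
   [zero_dimensional] only says that points are separated by clopen sets. *)
Definition covering_dim0 (R : realType) (X : topologicalType) : Prop :=
  forall U : set (set X),
    finite_set U -> (forall A, U A -> functionally_open R A) ->
    cover U id = [set: X] ->
    exists V : set (set X),
      [/\ finite_set V, (forall B, V B -> clopen B), trivIset V id,
          cover V id = [set: X] &
          forall B, V B -> exists2 A, U A & B `<=` A].

(* Main.v *)
Require Import Defs.
From mathcomp Require Import all_boot all_order all_algebra.
From mathcomp Require Import all_classical all_reals all_analysis.
From mathcomp Require Import ring lra.

(** Discreteness is inherited by images under maps that refine the topology: if
    [e : T -> S] is arbitrary and the topology induced on [T] by [e] is finer
    than that of [T], then [e] sends discrete subsets of [T] to discrete subsets
    of [S] ([discrete_subspace_image]).  So it suffices to map each of C_p(X)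
    and C_p^2(X) into the other by such an [e], with [e f] separating all the
    pairs of points that [f] separates.

    From C_p(X) to C_p^2(X) the diagonal will do, because the first projection
    is a continuous left inverse of it.

    From C_p^n(X) to C_p(X), the map packs n real functions into a single one
    ([exists_code]).  As dim X = 0, for every coordinate [i] and all rationals
    [p < q] there is a clopen set that contains [{f_i <= p}] and lies in
    [{f_i < q}] ([clopen_between]).  These countably many clopen sets, read as
    ternary digits 0 and 2, form a continuous function [e f] from X to the
    Cantor set.  Some finite set of digits of [e f x] confines [f i x] to a
    prescribed small interval, and every [g] such that [e g x] is close enough
    to [e f x] has these digits at [x] too ([ternary_digits]), so that [g i x]
    lies in the same interval; this says that [e] refines the topology.  If
    [f i x < f i y], a cut between the two values contains [x] but not [y], so
    [e f] separates the two points. *)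

Set Implicit Arguments.
Unset Strict Implicit.
Unset Printing Implicit Defensive.

Import Order.TTheory GRing.Theory Num.Theory.
Import numFieldNormedType.Exports.

Local Open Scope classical_set_scope.
Local Open Scope ring_scope.

(** * Discrete subspaces and refining maps *)

Lemma discrete_subspaceP (T : topologicalType) (A : set T) :
  discrete_subspace A <->
  forall x, A x -> exists2 U, nbhs x U & forall y, A y -> U y -> y = x.
Proof.
split=> [dA x Ax|dA].
  have : nbhs (SigSub (mem_set Ax) : A) [set SigSub (mem_set Ax)].
    by rewrite dA => y ->.
  case=> _ [[V oV <-] Vx VA]; exists V; first exact: open_nbhs_nbhs.
  by move=> y Ay Vy; have /(congr1 val) := VA (SigSub (mem_set Ay)) Vy.
apply/funext => x; apply/seteqP; split=> U.
  by move=> /nbhs_singleton Ux y ->.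
move=> /(_ x erefl) Ux.
have [V nV VA] := dA _ (set_mem (valP x)).
have : nbhs x (val @^-1` V) by exact: (@initial_continuous A T val x V nV).
apply: filterS => y Vy.
by rewrite (val_inj (VA _ (set_mem (valP y)) Vy)).
Qed.

(** A neighbourhood isolating [x] contains some [e @^-1` V] with [V] a
    neighbourhood of [e x], and [V] then isolates [e x] in the image. *)
Lemma discrete_subspace_image (S T : topologicalType) (e : T -> S) (D : set T) :
  continuous (id : initial_topology e -> T) ->
  discrete_subspace D -> discrete_subspace (e @` D).
Proof.
move=> ce /discrete_subspaceP dD; apply/discrete_subspaceP => _ [x Dx <-].
have [U /ce[_ [[V oV <-] Vx VU]] UD] := dD x Dx.
exists V; first exact: open_nbhs_nbhs.
by move=> _ [y Dy <-] Vy; rewrite (UD y Dy (VU y Vy)).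
Qed.

(** * Continuity in spaces of functions with the pointwise topology *)

Lemma continuous_ptws (I : Type) (Y T : topologicalType)
    (f : T -> {ptws I -> Y}) :
  (forall i, continuous (fun t => f t i)) -> continuous f.
Proof.
move=> cf t; apply/cvg_sup => i.
exact: (@continuous_comp_initial _ _ _ (fun g : {ptws I -> Y} => g i) f (cf i)).
Qed.

Lemma eval_continuous (R : realType) (X : topologicalType) (x : X) :
  continuous (fun f : Cp R X => f x).
Proof.
move=> f.
apply: (@continuous_comp _ {ptws X -> R} _ (fun f : Cp R X => (f : {ptws X -> R}))
   (fun g => g x)).
  exact: initial_continuous.
exact: (@proj_continuous {classic X}).
Qed.

Lemma continuous_Cpn (R : realType) (n : nat) (X T : topologicalType)
    (f : T -> Cpn R n X) :
  (forall i x, continuous (fun t => f t i x)) -> continuous f.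
Proof.
move=> cf; apply: continuous_ptws => i; apply: continuous_comp_initial.
by apply: continuous_ptws => x; exact: cf.
Qed.

(** * Ternary expansions with digits 0 and 2 *)

(** The usual embedding of the Cantor space into [[0, 1]]. *)
Definition ternary (R : realType) (b : nat -> bool) : R :=
  limn (series (fun k => (2 * b k)%:R / 3 ^+ k.+1 : R)).

Section ternary.
Variable R : realType.
Implicit Types (b c : nat -> bool) (N k : nat).

Let digits b : R^nat := fun k => (2 * b k)%:R / 3 ^+ k.+1.

Let digits_ge0 b k : 0 <= digits b k.
Proof. by rewrite divr_ge0 ?exprn_ge0. Qed.

Let digits_le b k : digits b k <= geometric (2 / 3) 3^-1 k.
Proof.
rewrite /digits /= exprS invfM mulrA -exprVn ler_wpM2r ?exprn_ge0 ?invr_ge0//.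
by rewrite ler_wpM2r ?invr_ge0// ler_nat; case: (b k).
Qed.

Let cvg_bound : series (geometric (2 / 3) 3^-1) @ \oo --> (1 : R).
Proof.
have := @cvg_geometric_series R (2 / 3) 3^-1.
rewrite (_ : 2 / 3 * (1 - 3^-1)^-1 = 1 :> R); last by field.
by apply; rewrite ger0_norm ?invr_ge0// invf_lt1// ltr1n.
Qed.

Lemma is_cvg_ternary b : cvgn (series (digits b)).
Proof.
apply: (series_le_cvg (digits_ge0 b) _ (digits_le b)); last exact: cvgP cvg_bound.
by move=> k; exact: le_trans (digits_ge0 b k) (digits_le b k).
Qed.

Lemma ternary_itv b : 0 <= ternary R b <= 1.
Proof.
have cv := @is_cvg_ternary b; apply/andP; split.
  by apply: limr_ge => //; apply: nearW => n; exact: sumr_ge0.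
rewrite -(cvg_lim _ cvg_bound)//; apply: ler_lim cv (cvgP _ cvg_bound) _.
by apply: nearW => n; apply: ler_sum => k _; exact: digits_le.
Qed.

(** Self-similarity of the Cantor set; together with [ternary_itv] it is all
    that the two comparisons below use, each by induction on the number of
    digits. *)
Lemma ternary_rec b :
  ternary R b = ((2 * b 0)%:R + ternary R (fun k => b k.+1)) / 3.
Proof.
apply: cvg_lim => //; rewrite -cvg_shiftS.
rewrite (_ : [sequence _]_n =
    (fun n => ((2 * b 0)%:R + series (digits (fun k => b k.+1)) n) / 3)).
  by apply: cvgMr_tmp; apply: cvgD; [exact: cvg_cst|exact: is_cvg_ternary].
apply/funext => n /=; rewrite /series /= big_nat_recl// mulrDl expr1.
congr (_ + _); rewrite mulr_suml; apply: eq_bigr => k _.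
by rewrite /digits (exprS _ k.+1) invfM; ring.
Qed.

Lemma ternary_near b c N : (forall k, (k < N)%N -> b k = c k) ->
  `|ternary R b - ternary R c| <= 3^-1 ^+ N.
Proof.
elim: N b c => [|N IH] b c bc.
  rewrite expr0 ler_norml.
  by have := ternary_itv b; have := ternary_itv c; lra.
have /IH : forall k, (k < N)%N -> b k.+1 = c k.+1 by move=> k kN; exact: bc.
rewrite (ternary_rec b) (ternary_rec c) (bc 0)// exprS !ler_norml.
lra.
Qed.

(** Expansions that differ in the first digit lie in the two outer thirds of
    [[0, 1]], at distance at least 1/3. *)
Lemma ternary_digits b c N : `|ternary R b - ternary R c| < 3^-1 ^+ N ->
  forall k, (k < N)%N -> b k = c k.
Proof.
elim: N b c => // N IH b c; rewrite (ternary_rec b) (ternary_rec c).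
set b' := (fun k => b k.+1); set c' := (fun k => c k.+1).
have := ternary_itv b'; have := ternary_itv c'.
have : (3^-1 : R) ^+ N <= 1 by rewrite exprn_ile1// ?invr_ge0// invf_le1// ler1n.
rewrite exprS ltr_norml => N1 c01 b01 bc.
have bc0 : b 0 = c 0.
  by case: (b 0) (c 0) bc => -[] //=; rewrite ?muln0 ?muln1; lra.
have /IH bc' : `|ternary R b' - ternary R c'| < 3^-1 ^+ N.
  by move: bc; rewrite bc0 ltr_norml; lra.
by case=> // k /bc'.
Qed.

Lemma ternary_inj b c : ternary R b = ternary R c -> b = c.
Proof.
move=> bc; apply/funext => k; apply: (@ternary_digits _ _ k.+1) => //.
by rewrite bc subrr normr0 exprn_gt0// invr_gt0.
Qed.

(** Each digit is locally constant, and finitely many digits control the sum up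
    to a given error. *)
Lemma ternary_clopen_continuous (X : topologicalType) (C : nat -> set X) :
  (forall k, clopen (C k)) -> continuous (fun x => ternary R (fun k => x \in C k)).
Proof.
move=> clC x; apply/cvgrPdist_lt => e e0.
have [N Ne] : exists N, (3^-1 : R) ^+ N < e.
  have : `|3^-1 : R| < 1 by rewrite ger0_norm ?invr_ge0// invf_lt1// ltr1n.
  move=> /cvg_expr/cvgrPdist_lt/(_ e e0)[N _ /(_ N (leqnn N))] /=.
  rewrite sub0r normrN ger0_norm ?exprn_ge0 ?invr_ge0// => Ne.
  by exists N.
have : \forall y \near x, forall k : 'I_N, (x \in C k) = (y \in C k).
  apply: filter_forall => k; have [oC cC] := clC k.
  have [xC|xC] := boolP (x \in C k).
    by apply: filterS (open_nbhs_nbhs (conj oC (set_mem xC))) => y /mem_set ->.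
  have xC' : (~` C k) x by move/negP: xC => xC /mem_set.
  apply: filterS (open_nbhs_nbhs (conj (closed_openC cC) xC')) => y yC.
  by apply/esym/negbTE/negP => /set_mem.
apply: filterS => y xy; apply: le_lt_trans Ne; apply: ternary_near => k kN.
exact: (xy (Ordinal kN)).
Qed.

End ternary.

(** * Coding finitely many real functions by one *)

(** [{f > p}] and [{f < q}] form a functionally open cover; the union of the
    members of a clopen refinement that lie in [{f < q}] cuts as required. *)
Lemma clopen_between (R : realType) (X : topologicalType) (f : X -> R) (p q : R) :
  covering_dim0 R X -> continuous f -> p < q ->
  exists C : set X, [/\ clopen C, forall x, f x <= p -> C x &
    forall x, C x -> f x < q].
Proof.
move=> dim0 cf pq.
pose A := [set x | p < f x]; pose B := [set x | f x < q].
have fopen (g : X -> R) : continuous g -> functionally_open R [set x | 0 < g x].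
  move=> cg; exists (fun x => Num.max (g x) 0).
    by move=> x; apply: continuous_max; [exact: cg|exact: cvg_cst].
  apply/seteqP; split=> x /=; first by move=> gx; rewrite max_l ?ltW//; lra.
  by case: ltP.
have [] := dim0 [set A; B].
- exact: finite_set2.
- move=> _ [->|->].
    rewrite (_ : A = [set x | 0 < f x - p]).
      by apply: fopen => x; apply: cvgB; [exact: cf|exact: cvg_cst].
    by apply/seteqP; split=> x; rewrite /A /= subr_gt0.
  rewrite (_ : B = [set x | 0 < q - f x]).
    by apply: fopen => x; apply: cvgB; [exact: cvg_cst|exact: cf].
  by apply/seteqP; split=> x; rewrite /B /= subr_gt0.
- apply/seteqP; split=> // x _; have [xq|xq] := ltP (f x) q.
    by exists B => //; right.
  by exists A; [left|rewrite /A /=; lra].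
move=> V [finV clV _ coverV refV].
exists (\bigcup_(W in V `&` [set W | W `<=` B]) W); split.
- split; first by apply: bigcup_open => W [/clV[]].
  apply: closed_bigcup; first exact: finite_setIl.
  by move=> W [/clV[]].
- move=> x xp; have : cover V id x by rewrite coverV.
  move=> [W VW Wx]; exists W => //; split=> //.
  have [_ [->|->] WA //] := refV W VW.
  by have := WA x Wx; rewrite /A /=; lra.
- by move=> x [W [_ WB] /WB].
Qed.

(** The index [k] of a cut depends on the coordinate and the rationals only, not
    on [f]: this is what makes the digits of two different functions
    comparable. *)
Lemma clopen_cuts (R : realType) (n : nat) (X : topologicalType) :
  covering_dim0 R X ->
  exists C : Cpn R n X -> nat -> set X,
    (forall f k, clopen (C f k)) /\
    forall (i : 'I_n) (p q : rat), p < q -> exists k, forall f : Cpn R n X,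
      (forall x, f i x <= ratr p -> C f k x) /\
      (forall x, C f k x -> f i x < ratr q).
Proof.
move=> dim0.
have cut (a : Cpn R n X * ('I_n * (rat * rat))) : exists C : set X, clopen C /\
    (a.2.2.1 < a.2.2.2 -> (forall x, a.1 a.2.1 x <= ratr a.2.2.1 -> C x) /\
      (forall x, C x -> a.1 a.2.1 x < ratr a.2.2.2)).
  case: a => f [i [p q]] /=; have [pq|_] := ltP p q; last first.
    by exists set0; split=> //; exact: clopen0.
  have pqR : ratr p < ratr q :> R by rewrite ltr_rat.
  by have [C [? ? ?]] := clopen_between dim0 (@cts_fun _ _ (f i)) pqR; exists C.
have [C CP] := choice cut.
exists (fun f k => if unpickle k is Some a then C (f, a) else set0); split.
  move=> f k; case: unpickle => [a|]; first by case: (CP (f, a)).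
  exact: clopen0.
move=> i p q pq; exists (pickle (i, (p, q))) => f; rewrite pickleK.
by have [_] := CP (f, (i, (p, q))); exact.
Qed.

(** Closeness of [e g x] to [e f x] transfers two well-chosen digits from [f] to
    [g], and these confine [g i x] to a small interval around [f i x]. *)
Lemma exists_code (R : realType) (n : nat) (X : topologicalType) :
  covering_dim0 R X ->
  exists e : Cpn R n X -> Cp R X,
    continuous (id : initial_topology e -> Cpn R n X) /\
    forall (f : Cpn R n X) i x y, f i x <> f i y -> e f x <> e f y.
Proof.
move=> /(@clopen_cuts R n X)[C [clC cutC]].
pose e f : Cp R X := mkcts (@ternary_clopen_continuous R X (C f) (clC f)).
have eE f x : e f x = ternary R (fun k => x \in C f k) by [].
exists e; split.
  apply: continuous_Cpn => i x f.
  have nbhs_f : Filter (nbhs (f : initial_topology e)) := nbhs_filter _.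
  apply/cvgrPdist_lt => eps eps0.
  have between (a b : R) : a < b -> exists2 p : rat, a < ratr p & ratr p < b.
    by move=> /rat_in_itvoo[p]; rewrite in_itv /= => /andP[]; exists p.
  (* With f_i(x) - eps < p < q < f_i(x) < p' < q' < f_i(x) + eps, the point x
     lies in the cut at (p', q') but not in the cut at (p, q); the same for g
     gives p < g_i(x) < q'. *)
  have [q q1 q2] : exists2 q : rat, f i x - eps < ratr q & ratr q < f i x.
    by apply: between; lra.
  have [p p1 p2] := between _ _ q1.
  have [q' q'1 q'2] : exists2 q : rat, f i x < ratr q & ratr q < f i x + eps.
    by apply: between; lra.
  have [p' p'1 p'2] := between _ _ q'1.
  have [k kP] := cutC i p q ltac:(by rewrite -(ltr_rat R)).
  have [l lP] := cutC i p' q' ltac:(by rewrite -(ltr_rat R)).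
  pose N := (maxn k l).+1.
  have : \forall g \near (f : initial_topology e),
      `|e f x - e g x| < 3^-1 ^+ N.
    have c : continuous (fun g : initial_topology e => e g x).
      move=> g; apply: (@continuous_comp (initial_topology e) (Cp R X) R e
        (fun h : Cp R X => h x)).
        exact: initial_continuous.
      exact: eval_continuous.
    by have /cvgrPdist_lt := c f; apply; rewrite exprn_gt0// invr_gt0.
  apply: filterS => g; rewrite !eE => /ternary_digits fg.
  have /eqP := fg k (leq_maxl _ _); have /eqP := fg l (leq_maxr _ _).
  have xl : x \in C f l by apply/mem_set/(lP f).1; exact: ltW.
  have xk : (x \in C f k) = false.
    by apply/negbTE/negP => /set_mem/(kP f).2; lra.
  rewrite xl xk => /eqP/esym/set_mem/(lP g).2 gq' /eqP/esym/negbT/negP gk.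
  have gp : ratr p < g i x.
    by rewrite ltNge; apply/negP => /(kP g).1/mem_set.
  by rewrite ltr_norml; lra.
have sep (f : Cpn R n X) i x y : f i x < f i y -> e f x <> e f y.
  move=> xy; have [p] := rat_in_itvoo xy; rewrite in_itv /= => /andP[xp py].
  have [q] := rat_in_itvoo py; rewrite in_itv /= => /andP[pq qy].
  have [k kP] := cutC i p q ltac:(by rewrite -(ltr_rat R)).
  rewrite !eE => /ternary_inj/(congr1 (fun b => b k)) xyk.
  have : x \in C f k by apply/mem_set/(kP f).1; exact: ltW.
  by rewrite xyk => /set_mem/(kP f).2; lra.
move=> f i x y /eqP; rewrite neq_lt => /orP[/sep//|/sep xy yx].
by apply: xy.
Qed.

Theorem corollary2p19 (R : realType) (X : topologicalType)
    (X_infinite : infinite_set [set: X])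
    (X_tychonoff : tychonoff_space X)
    (X_dim0 : covering_dim0 R X) :
  (exists F : set (Cp R X), point_separating F /\ discrete_subspace F) <->
  (exists F : set (Cpn R 2 X),
     point_separating_n F /\ discrete_subspace F).
Proof.
split=> -[F [sepF discF]].
  pose diag (f : Cp R X) : Cpn R 2 X := fun=> f.
  exists (diag @` F); split.
    move=> x y /sepF[f Ff fxy]; exists (diag f); first by exists f.
    by exists ord0.
  apply: discrete_subspace_image discF => f.
  apply: (@continuous_comp (initial_topology diag) (Cpn R 2 X) (Cp R X)
    diag (fun g => g ord0)); first exact: initial_continuous.
  exact: (@proj_continuous 'I_2 (fun=> Cp R X)).
have [e [ce sepe]] := @exists_code R 2 X X_dim0.
exists (e @` F); split; last exact: discrete_subspace_image discF.
move=> x y /sepF[f Ff [i fxy]]; exists (e f); first by exists f.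
exact: sepe fxy.
Qed.
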